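(* Let $\mathbb K$ be a field of characteristic $0$, let $\ell\ge2$, and let $(d_{n,k})_{n,k\ge0}=(g;f_1,f_2,\ldots,f_\ell)$ be a multiple Riordan type array, where $g,f_i\in\mathcal F^{(\ell)}_0$, $i=1,2,\ldots,\ell$, with $g(0)\ne0$. Let $(\tilde d_{n,k})_{n,k\ge0}=(g;tf_1,tf_2,\ldots,tf_\ell)$ be the multiple Riordan array associated with it. Let $h=\sqrt[\ell]{f_1f_2\cdots f_\ell}$, and let $\overline{th}$ be the compositional inverse of $th$. Then: (a) There exists the $A$-sequence $(a_0,a_1,\ldots)$ for $(g;f_1,\ldots,f_\ell)$ such that $$d_{n,k}=\sum_{j\ge0}a_j\,d_{n-j\ell,\,k+\ell(j-1)}\qquad (n\ge0,\ k\ge\ell),$$ or equivalently, the generating function $A(t)=\sum_{j\ge0}a_jt^{j\ell}$ of the $A$-sequence satisfies $$A(th)=h^\ell,\quad\text{or equivalently}\quad A(t)=\frac{t^\ell}{\overline{th}^{\,\ell}}.$$ (b) There also exists the $Z_0$-sequence $(z_{0,0},z_{0,1},\ldots)$ for $(g;f_1,\ldots,f_\ell)$ such that $$d_{n,0}=\sum_{j\ge0}z_{0,j}\,d_{n-(j+1)\ell,\,j\ell}\qquad (n\ge1),$$ or equivalently, the generating function $Z_0(t)=\sum_{j\ge0}z_{0,j}t^{j\ell}$ of the $Z_0$-sequence satisfies $$Z_0(t)=\frac1{\overline{th}^{\,\ell}}\left(1-\frac{g_0}{g(\overline{th})}\right).$$ (c) For each $m=1,2,\ldots,\ell-1$ there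 exists the $Z_m$-sequence $(z_{m,0},z_{m,1},\ldots)$ for $(g;f_1,\ldots,f_\ell)$ such that $$d_{n,m}=\sum_{j\ge0}z_{m,j}\,d_{n-(j+1)\ell,\,m+j\ell}\qquad (n\ge1),$$ or equivalently, the generating function $Z_m(t)=\sum_{j\ge0}z_{m,j}t^{j\ell}$ of the $Z_m$-sequence satisfies $$Z_m(t)=\frac1{\overline{th}^{\,\ell}}\left(1-\frac{g_0\,f_{1,1}\cdots f_{m,1}\,\overline{th}^{\,m}}{g(\overline{th})\,f_1(\overline{th})\cdots f_m(\overline{th})}\right),$$ where $f_{i,1}=[t]f_i$, $i=1,2,\ldots,m$.
   Context: $\mathcal F^{(\ell)}=\mathbb K[[t^\ell]]$ is the set of formal power series in $t^\ell$. The order of $f(t)=\sum_{k\ge0}f_kt^{\ell k}\in\mathcal F^{(\ell)}$ is the minimal $r$ with $f_r\ne0$, and $\mathcal F^{(\ell)}_0$ is the set of those of order $0$. $[t^n]F$ denotes the coefficient of $t^n$ in $F$, and $g_0=g(0)$. The entries of the multiple Riordan type array $(g;f_1,\ldots,f_\ell)$ are $$d_{n,k}=[t^n]\,g\,f_1^{\lfloor (k+\ell-1)/\ell\rfloor}f_2^{\lfloor (k+\ell-2)/\ell\rfloor}\cdots f_\ell^{\lfloor k/\ell\rfloor},\qquad n,k\ge0,$$ so successive columns have generating functions $g,gf_1,gf_1f_2,\ldots,gf_1\cdots f_\ell,gf_1^2f_2\cdots f_\ell,\ldots$. The entries $\tilde d_{n,k}$ of the associated array are given by the same formula with each $f_i$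 replaced by $tf_i$. Entries with negative row index are $0$. $A(th)$ denotes the composition of $A$ with the series $t\,h(t)$, and $\overline{th}$ is the inverse of $t\,h(t)$ under composition.
   Formalization: In (c) the printed formula fails, since f_{i,1}=[t]f_i=0 for f_i in K[[t^ℓ]], ℓ≥2, leaving 1/(\overline{th})^ℓ, not a power series; the formal version replaces each f_i in that formula by tf_i, so f_{i,1} becomes [t](tf_i)=f_i(0). *)

(* Defs.v *)
From HB Require Import structures.
From mathcomp Require Import all_boot all_order all_algebra.
From mathcomp Require Import boolp.

Set Implicit Arguments.
Unset Strict Implicit.
Unset Printing Implicit Defensive.

Import GRing.Theory.
Local Open Scope ring_scope.

(* The ring K[[t]] of formal power series, as sequences of coefficients with
   the Cauchy product.  It is made an integral domain, so that quotients of
   series can be written in its field of fractions K((t)). *)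

Record fps (K : fieldType) := Fps { fps_fun : nat -> K }.

Notation "{ 'fps' K }" := (fps K) (at level 0, format "{ 'fps'  K }").

Definition coeft (K : fieldType) (n : nat) (F : {fps K}) : K := fps_fun F n.
Notation "[t^ n ] F" := (coeft n F)
  (at level 10, n at level 8, F at level 8, format "[t^ n ]  F") : ring_scope.

Section PowerSeries.
Variable K : fieldType.
Implicit Types (f g h u : {fps K}) (n : nat).

HB.instance Definition _ := gen_eqMixin {fps K}.
HB.instance Definition _ := gen_choiceMixin {fps K}.

Lemma fpsP f g : (forall n, [t^ n] f = [t^ n] g) <-> f = g.
Proof.
split=> [|->] //; case: f g => [f] [g] efg; congr Fps.
exact: functional_extensionality_dep.
Qed.

Definition fpsC (c : K) : {fps K} := Fps (fun n => if n == 0%N then c else 0).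
Definition fpsX : {fps K} := Fps (fun n => (n == 1%N)%:R).
Definition fps_opp f : {fps K} := Fps (fun n => - [t^ n] f).
Definition fps_add f g : {fps K} := Fps (fun n => [t^ n] f + [t^ n] g).
Definition fps_mul f g : {fps K} :=
  Fps (fun n => \sum_(i < n.+1) [t^ i] f * [t^ (n - i)] g).

Fact fps_addA : associative fps_add.
Proof. by move=> f g h; apply/fpsP => n; exact: addrA. Qed.
Fact fps_addC : commutative fps_add.
Proof. by move=> f g; apply/fpsP => n; exact: addrC. Qed.
Fact fps_add0 : left_id (fpsC 0) fps_add.
Proof. by move=> f; apply/fpsP => -[|n]; exact: add0r. Qed.
Fact fps_addN : left_inverse (fpsC 0) fps_opp fps_add.
Proof. by move=> f; apply/fpsP => -[|n]; exact: addNr. Qed.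

HB.instance Definition _ :=
  GRing.isZmodule.Build {fps K} fps_addA fps_addC fps_add0 fps_addN.

Let trunc n f : {poly K} := \poly_(i < n) [t^ i] f.

Fact coeft_mul_trunc n m f g :
  (m < n)%N -> [t^ m] (fps_mul f g) = (trunc n f * trunc n g)`_m.
Proof.
move=> ltmn; rewrite coefM; apply: eq_bigr => i _.
have ltin : (i < n)%N by rewrite (leq_ltn_trans _ ltmn) // -ltnS.
by rewrite !coef_poly ltin (leq_ltn_trans (leq_subr _ _) ltmn).
Qed.

Fact fps_mulC : commutative fps_mul.
Proof.
by move=> f g; apply/fpsP => n; rewrite !(@coeft_mul_trunc n.+1) // mulrC.
Qed.

Fact fps_mulA : associative fps_mul.
Proof.
move=> f g h; apply/fpsP => n.
transitivity ((trunc n.+1 f * (trunc n.+1 g * trunc n.+1 h))`_n).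
  rewrite coefM; apply: eq_bigr => i _.
  by rewrite -coeft_mul_trunc ?ltnS ?leq_subr // coef_poly ltn_ord.
rewrite mulrA coefM; apply: eq_bigr => i _.
by rewrite -coeft_mul_trunc // coef_poly ltnS leq_subr.
Qed.

Fact fps_mul1 : left_id (fpsC 1) fps_mul.
Proof.
move=> f; apply/fpsP => n; rewrite [LHS]big_ord_recl big1 => [|i _].
  by rewrite /= subn0 mul1r addr0.
by rewrite [X in X * _]/= mul0r.
Qed.

Fact fps_mulDl : left_distributive fps_mul fps_add.
Proof.
move=> f g h; apply/fpsP => n; rewrite /coeft /= -big_split.
by apply: eq_bigr => i _; exact: mulrDl.
Qed.

Fact fps_oner_neq0 : fpsC 1 != 0.
Proof.
by apply/eqP => /fpsP /(_ 0%N) /eqP; rewrite /coeft /= oner_eq0.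
Qed.

HB.instance Definition _ := GRing.Zmodule_isComNzRing.Build {fps K}
  fps_mulA fps_mulC fps_mul1 fps_mulDl fps_oner_neq0.

Lemma coeft0 n : [t^ n] (0 : {fps K}) = 0. Proof. by case: n. Qed.
Lemma coeft1 n : [t^ n] (1 : {fps K}) = (n == 0%N)%:R. Proof. by case: n. Qed.
Lemma coeftC c n : [t^ n] (fpsC c) = if n == 0%N then c else 0.
Proof. by []. Qed.
Lemma coeftX n : [t^ n] fpsX = (n == 1%N)%:R. Proof. by []. Qed.
Lemma coeftN f n : [t^ n] (- f) = - [t^ n] f. Proof. by []. Qed.
Lemma coeftD f g n : [t^ n] (f + g) = [t^ n] f + [t^ n] g. Proof. by []. Qed.
Lemma coeftB f g n : [t^ n] (f - g) = [t^ n] f - [t^ n] g. Proof. by []. Qed.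
Lemma coeftM f g n :
  [t^ n] (f * g) = \sum_(i < n.+1) [t^ i] f * [t^ (n - i)] g.
Proof. by []. Qed.

Lemma coeft_sum (I : Type) (r : seq I) (P : pred I) (F : I -> {fps K}) n :
  [t^ n] (\sum_(i <- r | P i) F i) = \sum_(i <- r | P i) [t^ n] (F i).
Proof. exact: (big_morph _ (fun f g => coeftD f g n) (coeft0 n)). Qed.

Lemma coeftXn_small u k n :
  [t^ 0] u = 0 -> (n < k)%N -> [t^ n] (u ^+ k) = 0.
Proof.
move=> u0; elim: k n => // k IHk n ltnk; rewrite exprS coeftM.
rewrite big_ord_recl u0 mul0r add0r big1 // => i _; rewrite IHk ?mulr0 //.
by move: i ltnk; case: n => [[]//|n] i; rewrite ltnS subSS; apply/leq_ltn_trans/leq_subr.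
Qed.

(* If f_0 <> 0 then 1/f = f_0^-1 (1 + u + u^2 + ...) with u = 1 - f/f_0. *)
Definition fps_geom f : {fps K} := 1 - fpsC ([t^ 0] f)^-1 * f.
Definition fps_inv f : {fps K} :=
  if [t^ 0] f == 0 then f else
  Fps (fun n => [t^ n] (fpsC ([t^ 0] f)^-1 * \sum_(i < n.+1) fps_geom f ^+ i)).
Definition fps_unit : pred {fps K} := fun f => [t^ 0] f != 0.

Fact fps_mulV : {in fps_unit, left_inverse 1 fps_inv *%R}.
Proof.
move=> f; rewrite unfold_in => f0N; apply/fpsP => n.
have geom0 : [t^ 0] (fps_geom f) = 0.
  by rewrite coeftB coeftM big_ord1 coeftC coeft1 /= mulVf // subrr.
pose S N := \sum_(i < N) fps_geom f ^+ i.
rewrite /fps_inv (negbTE f0N).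
transitivity ([t^ n] (fpsC ([t^ 0] f)^-1 * S n.+1 * f)).
  rewrite !coeftM; apply: eq_bigr => i _; congr (_ * _).
  transitivity ([t^ i] (fpsC ([t^ 0] f)^-1 * S i.+1)) => //.
  rewrite !coeftM; apply: eq_bigr => j _; congr (_ * _).
  rewrite /S !coeft_sum.
  have le_in : (i.+1 <= n.+1)%N by exact: ltn_ord.
  rewrite (big_ord_widen n.+1 (fun k => [t^ (i - j)] (fps_geom f ^+ k)) le_in).
  rewrite big_mkcond; apply: eq_bigr => k _; case: ifP => // /negbT.
  rewrite -leqNgt => ltik; rewrite coeftXn_small //.
  exact: leq_ltn_trans (leq_subr _ _) ltik.
rewrite mulrAC.
have -> : fpsC ([t^ 0] f)^-1 * f = 1 - fps_geom f by rewrite subKr.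
by rewrite -opprB mulNr -subrX1 opprB coeftB coeftXn_small // subr0.
Qed.

Fact fps_unitPl f g : g * f = 1 -> fps_unit f.
Proof.
move=> /fpsP /(_ 0%N); rewrite coeftM big_ord1 coeft1 /= => gf1.
by apply/eqP => f0; move/eqP: gf1; rewrite f0 mulr0 eq_sym oner_eq0.
Qed.

Fact fps_inv_out : {in [predC fps_unit], fps_inv =1 id}.
Proof. by move=> f; rewrite inE unfold_in negbK /fps_inv => ->. Qed.

HB.instance Definition _ := GRing.ComNzRing_hasMulInverse.Build {fps K}
  fps_mulV fps_unitPl fps_inv_out.

Lemma fps_neq0P f :
  reflect (exists2 n, [t^ n] f != 0 & forall i, (i < n)%N -> [t^ i] f = 0)
          (f != 0).
Proof.
apply: (iffP idP) => [f0|[n + _]]; last first.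
  by apply: contra => /eqP ->; rewrite coeft0.
have ex_n : exists n, [t^ n] f != 0.
  apply: contrapT => noN; case/eqP: f0; apply/fpsP => n; rewrite coeft0.
  by apply: contrapT => /eqP fn; apply: noN; exists n.
exists (ex_minn ex_n); first by case: ex_minnP.
case: ex_minnP => n _ min_n i ltin; apply/eqP; apply: contraTT ltin.
by move=> /min_n; rewrite -leqNgt.
Qed.

Fact fps_mulf_eq0 f g : f * g = 0 -> (f == 0) || (g == 0).
Proof.
move=> fg0; apply: contraT; rewrite negb_or => /andP[].
move=> /fps_neq0P[m fm minm] /fps_neq0P[n gn minn].
move/fpsP: fg0 => /(_ (m + n)%N); rewrite coeft0 coeftM => /eqP.
have ltm : (m < (m + n).+1)%N by rewrite ltnS leq_addr.
rewrite (bigD1 (Ordinal ltm)) //= addKn big1 ?addr0 => [|i neim].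
  by rewrite mulf_eq0 (negbTE fm) (negbTE gn).
have [ltim|ltmi|eim] := ltngtP i m.
- by rewrite minm ?mul0r.
- rewrite minn ?mulr0 // ltn_subLR ?ltn_add2r //.
  by rewrite -ltnS ltn_ord.
- by case/eqP: neim; apply: val_inj.
Qed.

HB.instance Definition _ :=
  GRing.ComUnitRing_isIntegral.Build {fps K} fps_mulf_eq0.

(* The composition f(u), meaningful when u(0) = 0: then u^k has no term of
   degree less than k. *)
Definition fps_comp f u : {fps K} :=
  Fps (fun n => \sum_(k < n.+1) [t^ k] f * [t^ n] (u ^+ k)).

Definition is_comp_inverse u v : Prop :=
  [/\ [t^ 0] u = 0, [t^ 0] v = 0, fps_comp u v = fpsX & fps_comp v u = fpsX].

(* K[[t^l]]; the order of a member is counted in powers of t^l. *)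
Definition Fseries (l : nat) f : Prop :=
  forall n, ~~ (l %| n)%N -> [t^ n] f = 0.
Definition has_order (l : nat) f (r : nat) : Prop :=
  [t^ (l * r)] f != 0 /\ forall s, (s < r)%N -> [t^ (l * s)] f = 0.
Definition Fseries0 (l : nat) f : Prop := Fseries l f /\ has_order l f 0.

(* sum_(j >= 0) a_j t^(j l) *)
Definition gen_series (l : nat) (a : nat -> K) : {fps K} :=
  Fps (fun n => if (l %| n)%N then a (n %/ l)%N else 0).

(* The multipliers f_1, ..., f_l are indexed from 0: f_(i+1) is [f i]. *)
Definition riordan_col l g (f : 'I_l -> {fps K}) (k : nat) : {fps K} :=
  g * \prod_(i < l) f i ^+ ((k + l - i.+1) %/ l).
Definition riordan l g (f : 'I_l -> {fps K}) (n : int) (k : nat) : K :=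
  if n is Posz m then [t^ m] (riordan_col g f k) else 0.

(* The multipliers t f_1, ..., t f_l of the associated multiple Riordan array
   [riordan g (assoc_mult f)].  The coefficient f_(i,1) is [t^1](t f_i), that
   is f_i(0); the coefficient of t in f_i itself is 0 when f_i lies in
   K[[t^l]] with l >= 2. *)
Definition assoc_mult l (f : 'I_l -> {fps K}) (i : 'I_l) : {fps K} :=
  fpsX * f i.

(* In both recurrences the terms with j > n have a negative row index, so that
   the sums stop at j = n.  In the first one k >= l, hence k + l j - l is
   k + l (j - 1) even when j = 0. *)
Definition is_A_sequence l (d : int -> nat -> K) (a : nat -> K) : Prop :=
  forall n k : nat, (l <= k)%N ->
    d n k = \sum_(j < n.+1) a j * d (n%:Z - (j * l)%:Z) (k + l * j - l)%N.
Definition is_Z_sequence l (d : int -> nat -> K) (m : nat) (z : nat -> K) :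
    Prop :=
  forall n : nat, (1 <= n)%N ->
    d n m = \sum_(j < n.+1) z j * d (n%:Z - (j.+1 * l)%:Z) (m + j * l)%N.

End PowerSeries.

Arguments fpsX {K}.
Notation "''t'" := fpsX (at level 0) : ring_scope.
Notation "x %:F" := (@FracField.tofrac _ x) : ring_scope.

(* Main.v *)
Require Import Defs.
From HB Require Import structures.
From mathcomp Require Import all_boot all_order all_algebra.
From mathcomp Require Import boolp.
Set Implicit Arguments.
Unset Strict Implicit.
Unset Printing Implicit Defensive.
Import GRing.Theory.
Local Open Scope ring_scope.

(** Write P = f_1 ... f_l and C_m for the m-th column series, so that
    C_(m+jl) = C_m P^j.  The A-recurrence says exactly P = a(t^l P), where
    a(x) = sum_j a_j x^j, and the Z_m-recurrence says
    t^l C_m z(t^l P) = C_m - C_m(0).  Since P is a unit of K[[t^l]], these are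
    triangular systems with nonzero diagonal, whence existence and uniqueness
    (with no l-th root of P needed).  If h^l = P, then t^l P = (th)^l, and the
    closed formulas follow because composition with th is an injective ring
    morphism sending hb to t. *)

(** * Triangular linear systems over a field *)

Lemma triangular_system_unique_solution (K : fieldType) (c : nat -> nat -> K)
    (b : nat -> K) :
  (forall n, c n n != 0) ->
  exists! a : nat -> K, forall n, \sum_(j < n.+1) a j * c n j = b n.
Proof.
move=> c_diag.
(* Forward substitution: [step a n] solves equation [n] for its last unknown, reading only the
   entries of [a] below [n]. Entry [n] is therefore final after [n.+1] rounds, so iteration replaces
   a course-of-values recursion. *)
pose step (a : nat -> K) n := (b n - \sum_(j < n) a j * c n j) / c n n.
have step_stable k n : (n < k)%N ->
    iter k step (fun=> 0) n = iter n.+1 step (fun=> 0) n.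
  elim/ltn_ind: n k => n IHn [//|k] ltnk /=; rewrite /step.
  congr ((_ - _) / _); apply: eq_bigr => j _; congr (_ * _).
  by rewrite IHn ?(leq_trans (ltn_ord j)) // -(IHn j (ltn_ord j) n).
pose a n := iter n.+1 step (fun=> 0) n.
exists a; split=> [n|a' a'P].
  rewrite big_ord_recr /= {2}/a /= /step divfK //.
  rewrite addrC -addrA [X in _ + X](_ : _ = 0) ?addr0 //.
  apply/eqP; rewrite addrC subr_eq0; apply/eqP/eq_bigr => j _; congr (_ * _).
  by rewrite [RHS]step_stable.
apply: funext => n; elim/ltn_ind: n => n IHn.
rewrite /a /= /step -a'P big_ord_recr /= addrC -addrA.
rewrite [X in _ + X](_ : _ = 0) ?addr0 ?mulfK //.
apply/eqP; rewrite subr_eq0; apply/eqP/eq_bigr => j _; congr (_ * _).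
by rewrite -IHn // step_stable.
Qed.

(** * Coefficients and constants of power series *)

Section PowerSeriesTheory.
Variable K : fieldType.
Implicit Types (f g u v : {fps K}) (n k l : nat).

Lemma fps_unitE f : (f \is a GRing.unit) = ([t^ 0] f != 0).
Proof. by []. Qed.

Lemma coeft0M f g : [t^ 0] (f * g) = [t^ 0] f * [t^ 0] g.
Proof. by rewrite coeftM big_ord1. Qed.

Lemma coeft0_prod (I : Type) (r : seq I) (P : pred I) (F : I -> {fps K}) :
  [t^ 0] (\prod_(i <- r | P i) F i) = \prod_(i <- r | P i) [t^ 0] (F i).
Proof. by apply: (big_morph _ coeft0M); rewrite coeft1. Qed.

Lemma coeftXnM n k f :
  [t^ n] ('t ^+ k * f) = if (k <= n)%N then [t^ (n - k)] f else 0.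
Proof.
elim: k n => [|k IHk] n; first by rewrite expr0 mul1r leq0n subn0.
rewrite exprS -mulrA coeftM big_ord_recl coeftX mul0r add0r.
case: n => [|n]; first by rewrite big_ord0.
rewrite big_ord_recl coeftX mul1r big1 ?addr0 => [|i _].
  by rewrite !subSS subn0 IHk ltnS.
by rewrite coeftX mul0r.
Qed.

Lemma fpsX_neq0 : ('t : {fps K}) != 0.
Proof.
by apply/eqP => /fpsP /(_ 1%N) /eqP; rewrite coeftX coeft0 oner_eq0.
Qed.

Lemma coeftCM c f n : [t^ n] (fpsC c * f) = c * [t^ n] f.
Proof.
rewrite coeftM big_ord_recl subn0 coeftC big1 ?addr0 // => i _.
by rewrite coeftC mul0r.
Qed.

Fact fpsC_is_zmod_morphism : zmod_morphism (@fpsC K).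
Proof. by move=> x y; apply/fpsP => -[|n] //; rewrite coeftB !coeftC subr0. Qed.

Fact fpsC_is_monoid_morphism : monoid_morphism (@fpsC K).
Proof.
split=> // x y; apply/fpsP => n; rewrite coeftCM !coeftC.
by case: eqP; rewrite ?mulr0.
Qed.

HB.instance Definition _ :=
  GRing.isZmodMorphism.Build K {fps K} (@fpsC K) fpsC_is_zmod_morphism.
HB.instance Definition _ :=
  GRing.isMonoidMorphism.Build K {fps K} (@fpsC K) fpsC_is_monoid_morphism.

(** * Composition of power series *)

Lemma coeft_comp n f u :
  [t^ n] (fps_comp f u) = \sum_(k < n.+1) [t^ k] f * [t^ n] (u ^+ k).
Proof. by []. Qed.

(** The added terms vanish since [u ^+ k] has order at least [k]. A range independent of [n] is what
    allows sums to be exchanged below. *)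
Lemma coeft_comp_widen n N f u : [t^ 0] u = 0 -> (n < N)%N ->
  [t^ n] (fps_comp f u) = \sum_(k < N) [t^ k] f * [t^ n] (u ^+ k).
Proof.
move=> u0 ltnN; pose F k := [t^ k] f * [t^ n] (u ^+ k).
rewrite [LHS](big_ord_widen N F ltnN) big_mkcond; apply: eq_bigr => k _.
by case: ltnP => // ltnk; rewrite coeftXn_small ?mulr0.
Qed.

(** Reduces composition to polynomial evaluation, whose multiplicativity is known. Coefficients of
    [p] above [n] are left free, so a product of truncations qualifies. *)
Lemma coeft_comp_poly n (p : {poly K}) f u : [t^ 0] u = 0 ->
  (forall i, (i <= n)%N -> p`_i = [t^ i] f) ->
  [t^ n] (fps_comp f u) = [t^ n] (map_poly (@fpsC K) p).[u].
Proof.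
move=> u0 pf; rewrite (@coeft_comp_widen n (maxn n.+1 (size p))) ?leq_maxl //.
have sz_p : (size (map_poly (@fpsC K) p) <= maxn n.+1 (size p))%N.
  by rewrite (leq_trans (size_poly _ _)) // leq_maxr.
rewrite (horner_coef_wide _ sz_p) coeft_sum; apply: eq_bigr => k _.
rewrite coef_map coeftCM; have [/pf->//|ltnk] := leqP k n.
by rewrite coeftXn_small ?mulr0.
Qed.

Lemma fps_compC c u : fps_comp (fpsC c) u = fpsC c.
Proof.
apply/fpsP => n; rewrite coeft_comp big_ord_recl expr0 coeft1 coeftC /=.
rewrite big1 ?addr0; first by case: eqP; rewrite ?mulr1 ?mulr0.
by move=> i _; rewrite mul0r.
Qed.

Lemma fps_comp1 u : fps_comp 1 u = 1.
Proof. exact: fps_compC. Qed.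

Lemma fps_compB f g u : fps_comp (f - g) u = fps_comp f u - fps_comp g u.
Proof.
apply/fpsP => n; rewrite coeftB !coeft_comp -sumrB.
by apply: eq_bigr => i _; rewrite coeftB mulrBl.
Qed.

Lemma fps_compM f g u : [t^ 0] u = 0 ->
  fps_comp (f * g) u = fps_comp f u * fps_comp g u.
Proof.
move=> u0; apply/fpsP => n.
pose p (F : {fps K}) := \poly_(i < n.+1) [t^ i] F.
have pE F i : (i <= n)%N -> (p F)`_i = [t^ i] F.
  by move=> lein; rewrite coef_poly ltnS lein.
(* [p f * p g] may differ from the truncation of [f * g], but only above degree [n]. *)
rewrite (@coeft_comp_poly n (p f * p g)) // => [|i lein].
  rewrite rmorphM hornerM !coeftM; apply: eq_bigr => i _.
  have le_in : (i <= n)%N by rewrite -ltnS.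
  by congr (_ * _); symmetry; apply: coeft_comp_poly => // j leji;
     rewrite pE // (leq_trans leji) ?leq_subr.
rewrite coefM coeftM; apply: eq_bigr => j _.
have leji : (j <= i)%N by rewrite -ltnS.
by rewrite !pE // (leq_trans _ lein) ?leq_subr.
Qed.

Lemma fps_compXn f u k : [t^ 0] u = 0 ->
  fps_comp (f ^+ k) u = fps_comp f u ^+ k.
Proof.
move=> u0; elim: k => [|k IHk]; first exact: fps_comp1.
by rewrite !exprS fps_compM ?IHk.
Qed.

Lemma fps_comp_prod (I : Type) (r : seq I) (P : pred I) (F : I -> {fps K}) u :
  [t^ 0] u = 0 ->
  fps_comp (\prod_(i <- r | P i) F i) u = \prod_(i <- r | P i) fps_comp (F i) u.
Proof.
move=> u0; apply: (big_morph (fun w => fps_comp w u) _ (fps_comp1 u)) => x y.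
exact: fps_compM.
Qed.

Lemma fps_compX f : fps_comp f 't = f.
Proof.
apply/fpsP => n; rewrite coeft_comp big_ord_recr /= big1 ?add0r => [|i _].
  by rewrite -[_ ^+ _]mulr1 coeftXnM leqnn subnn coeft1 mulr1.
rewrite -['t ^+ i]mulr1 coeftXnM ltnW // coeft1 subn_eq0 leqNgt ltn_ord.
by rewrite mulr0.
Qed.

Lemma fps_compXl u : [t^ 0] u = 0 -> fps_comp 't u = u.
Proof.
(* The range [n.+2] contains the index 1 even when [n] is 0. *)
move=> u0; apply/fpsP => n; rewrite (@coeft_comp_widen n n.+2) //.
rewrite !big_ord_recl !coeftX mul0r add0r mul1r expr1 big1 ?addr0 //.
by move=> i _; rewrite coeftX mul0r.
Qed.

Lemma fps_compA f u v : [t^ 0] u = 0 -> [t^ 0] v = 0 ->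
  fps_comp (fps_comp f u) v = fps_comp f (fps_comp u v).
Proof.
move=> u0 v0; apply/fpsP => n; rewrite !coeft_comp.
under eq_bigr => k _ do rewrite (coeft_comp_widen _ u0 (ltn_ord k)) mulr_suml.
rewrite exchange_big; apply: eq_bigr => j _ /=.
rewrite -fps_compXn // coeft_comp mulr_sumr.
by apply: eq_bigr => k _; rewrite mulrA.
Qed.

(** For [f = Fps a] this turns an equation between series into linear equations in the unknowns
    [a j]; the right-hand sides of the recurrences have this shape. *)
Lemma coeftM_comp n f g u : [t^ 0] u = 0 ->
  [t^ n] (g * fps_comp f u) = \sum_(j < n.+1) [t^ j] f * [t^ n] (g * u ^+ j).
Proof.
move=> u0; rewrite coeftM.
under eq_bigr => i _ do
  rewrite (@coeft_comp_widen _ n.+1) ?ltnS ?leq_subr // mulr_sumr.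
rewrite exchange_big; apply: eq_bigr => j _; rewrite coeftM mulr_sumr.
by apply: eq_bigr => i _; rewrite mulrCA.
Qed.

(** Links the generating functions of the theorem, in powers of $t^l$, to [Fps a], for which the
    linear systems are stated. *)
Lemma fps_comp_gen_series l (a : nat -> K) u : (0 < l)%N -> [t^ 0] u = 0 ->
  fps_comp (gen_series l a) u = fps_comp (Fps a) (u ^+ l).
Proof.
move=> l_gt0 u0; apply/fpsP => n.
pose F k := [t^ k] (gen_series l a) * [t^ n] (u ^+ k).
(* The sum is extended to [n.+1] blocks of length [l]; in each block only the first index is a
   multiple of [l]. *)
have le_nl : (n.+1 <= n.+1 * l)%N by rewrite leq_pmulr.
rewrite (coeft_comp_widen _ u0 le_nl) coeft_comp.
rewrite -(big_mkord xpredT F) big_nat_mul big_mkord; apply: eq_bigr => j _.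
rewrite big_ltn ?ltn_pmul2r // big_nat big1 => [|i /andP[ltji ltij]].
  by rewrite /F {1}/coeft /= dvdn_mull // mulnK // addr0 mulnC exprM.
rewrite /F {1}/coeft /=; case: dvdnP => [[q iE]|_]; last by rewrite mul0r.
move: ltji ltij; rewrite iE !ltn_pmul2r // => ltjq.
by rewrite ltnS leqNgt ltjq.
Qed.

(** * The ring $K[[t^l]]$ and equations in it *)

Lemma Fseries1 l : Fseries l (1 : {fps K}).
Proof. by move=> [|n]; rewrite ?dvdn0 // coeft1. Qed.

Lemma FseriesM l f g : Fseries l f -> Fseries l g -> Fseries l (f * g).
Proof.
move=> Ff Fg n nl; rewrite coeftM big1 // => i _.
have [il|/Ff->] := boolP (l %| i)%N; last by rewrite mul0r.
rewrite Fg ?mulr0 //; apply: contra nl => nil.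
by rewrite -(@subnK i n) -1?ltnS // dvdn_add.
Qed.

Lemma FseriesXn l f k : Fseries l f -> Fseries l (f ^+ k).
Proof.
move=> Ff; elim: k => [|k IHk]; first exact: Fseries1.
by rewrite exprS; exact: FseriesM.
Qed.

Lemma Fseries_prod l (I : Type) (r : seq I) (P : pred I) (F : I -> {fps K}) :
  (forall i, P i -> Fseries l (F i)) -> Fseries l (\prod_(i <- r | P i) F i).
Proof.
move=> FF; apply: (big_ind (Fseries l)) => //; first exact: Fseries1.
by move=> f g; exact: FseriesM.
Qed.

Lemma Fseries0_unit l f : Fseries0 l f -> f \is a GRing.unit.
Proof. by case=> _ []; rewrite muln0 fps_unitE. Qed.

(* Every term lies in K[[t^l]] and the j-th one has order exactly l j, so the
   equation is a triangular system for the coefficients of t^(l n). *)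
Lemma exists_unique_comp_eq l (c p q : {fps K}) : (0 < l)%N ->
  Fseries l c -> Fseries l p -> Fseries l q ->
  c \is a GRing.unit -> p \is a GRing.unit ->
  exists! a : nat -> K, c * fps_comp (Fps a) ('t ^+ l * p) = q.
Proof.
move=> l_gt0 Fc Fp Fq c_unit p_unit.
have coef_term n j : [t^ n] (c * ('t ^+ l * p) ^+ j) =
    if (l * j <= n)%N then [t^ (n - l * j)] (c * p ^+ j) else 0.
  by rewrite exprMn -exprM mulrCA coeftXnM.
have y0 : [t^ 0] ('t ^+ l * p) = 0 by rewrite coeftXnM leqn0 gtn_eqF.
pose C n j := [t^ (l * n)] (c * ('t ^+ l * p) ^+ j).
have C_diag n : C n n != 0.
  by rewrite /C coef_term leqnn subnn -fps_unitE unitrM c_unit unitrX.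
have eq_system a : c * fps_comp (Fps a) ('t ^+ l * p) = q <->
    forall n, \sum_(j < n.+1) a j * C n j = [t^ (l * n)] q.
  have coef_l n : [t^ (l * n)] (c * fps_comp (Fps a) ('t ^+ l * p)) =
      \sum_(j < n.+1) a j * C n j.
    rewrite coeftM_comp //.
    rewrite [RHS](big_ord_widen (l * n).+1 (fun j => a j * C n j)) ?ltnS;
      last by rewrite leq_pmull.
    rewrite [RHS]big_mkcond; apply: eq_bigr => j _; case: ifP => // /negbT.
    rewrite -leqNgt => ltnj.
    by rewrite coef_term leq_pmul2l // leqNgt ltnj mulr0.
  split=> [eq_q n|sys]; first by rewrite -coef_l eq_q.
  apply/fpsP => n; have [/dvdnP[k ->]|nl] := boolP (l %| n)%N.
    by rewrite mulnC coef_l.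
  rewrite Fq // coeftM_comp // big1 // => j _; rewrite coef_term.
  case: ifP => [lejn|]; last by rewrite mulr0.
  rewrite (FseriesM Fc (FseriesXn _ Fp)) ?mulr0 //; apply: contra nl => nl.
  by rewrite -(subnK lejn) dvdn_add // dvdn_mulr.
have [a [aP a_uniq]] :=
  triangular_system_unique_solution (fun n => [t^ (l * n)] q) C_diag.
by exists a; split=> [|a' /eq_system]; [exact/eq_system | exact: a_uniq].
Qed.

Lemma exists_unique_iff (T : Type) (P Q : T -> Prop) :
  (forall x, P x <-> Q x) -> (exists! x, Q x) -> exists! x, P x.
Proof.
move=> PQ [x [Qx x_uniq]]; exists x.
by split=> [|y /PQ]; [exact/PQ | exact: x_uniq].
Qed.

End PowerSeriesTheory.

(** * Columns of the array and the recurrences as series identities *)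

Section RiordanColumns.
Variables (K : fieldType) (l : nat) (g : {fps K}) (f : 'I_l -> {fps K}).
Hypothesis l_gt0 : (0 < l)%N.
Let P := \prod_(i < l) f i.
Let C := riordan_col g f.

(** The zero convention for negative rows is exactly what multiplication by $t^s$ produces. *)
Lemma riordan_subn (n k s : nat) :
  riordan g f (n%:Z - s%:Z) k = [t^ n] ('t ^+ s * C k).
Proof.
rewrite coeftXnM; case: leqP => [lesn|ltns]; first by rewrite subzn.
by rewrite -opprB subzn 1?ltnW // -(subnSK ltns).
Qed.

(** Raising [k] by [j * l] raises every floor exponent by exactly [j]. *)
Lemma riordan_col_addl k j : C (k + j * l) = C k * P ^+ j.
Proof.
rewrite /C /riordan_col -mulrA; congr (_ * _).
rewrite -prodrXl -big_split; apply: eq_bigr => i _ /=; rewrite -exprD.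
rewrite -addnA (addnC _ l) addnA -addnBAC ?divnMDl //; last first.
  by rewrite (leq_trans (ltn_ord i)) // leq_addl.
by rewrite addnC [in RHS]addnC divnMDl.
Qed.

(** For [m < l] the exponent of [f i] is 1 when [i < m] and 0 otherwise. *)
Lemma riordan_col_small m : (m < l)%N ->
  C m = g * \prod_(i < l | (i < m)%N) f i.
Proof.
move=> ltml; congr (_ * _); rewrite [RHS]big_mkcond; apply: eq_bigr => i _.
case: ltnP => [ltim|leim].
  rewrite addnC -addnBA // divnDl ?dvdnn // divnn l_gt0.
  rewrite divn_small ?addn0 ?expr1 //.
  by rewrite (leq_ltn_trans (leq_subr _ _)).
rewrite divn_small // ltn_subLR ?ltnS ?leq_add2r //.
by rewrite (leq_trans (ltn_ord i)) ?leq_addl.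
Qed.

(** In column [k + l] the recurrence reads $C_k\,a(t^lP)=C_kP$. Column [l] alone yields the
    identity, by cancelling $C_0=g$; multiplying it by $C_k$ gives back all the columns. *)
Lemma is_A_sequenceP (a : nat -> K) : g != 0 ->
  is_A_sequence l (riordan g f) a <-> fps_comp (Fps a) ('t ^+ l * P) = P.
Proof.
move=> g_neq0.
have y0 : [t^ 0] ('t ^+ l * P) = 0 by rewrite coeftXnM leqn0 gtn_eqF.
have sumE n k : \sum_(j < n.+1)
      a j * riordan g f (n%:Z - (j * l)%:Z) (k + l + l * j - l)%N =
    [t^ n] (C k * fps_comp (Fps a) ('t ^+ l * P)).
  rewrite coeftM_comp //; apply: eq_bigr => j _; congr (_ * _).
  rewrite riordan_subn addnAC addnK [(l * j)%N]mulnC riordan_col_addl.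
  by rewrite exprMn -exprM mulnC mulrCA.
have C_addl k : C (k + l) = C k * P.
  by rewrite -{1}[l]mul1n riordan_col_addl expr1.
split=> [Aa|compP n k lelk].
  have C0 : C 0 = g.
    by rewrite riordan_col_small // big_pred0 ?mulr1 // => i; rewrite ltn0.
  apply: (mulfI g_neq0); apply/fpsP => n; rewrite -C0 -C_addl -sumE.
  by rewrite -Aa ?leq_addl.
by rewrite -(subnK lelk) sumE compP -C_addl.
Qed.

(** The recurrence starts at row 1. Row 0 adds no condition: the factor $t^l$ kills the left side
    there, and the subtracted constant kills the right side. *)
Lemma is_Z_sequenceP m (z : nat -> K) :
  is_Z_sequence l (riordan g f) m z <->
  't ^+ l * (C m * fps_comp (Fps z) ('t ^+ l * P)) = C m - fpsC ([t^ 0] (C m)).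
Proof.
have y0 : [t^ 0] ('t ^+ l * P) = 0 by rewrite coeftXnM leqn0 gtn_eqF.
have sumE n : \sum_(j < n.+1)
      z j * riordan g f (n%:Z - (j.+1 * l)%:Z) (m + j * l)%N =
    [t^ n] ('t ^+ l * (C m * fps_comp (Fps z) ('t ^+ l * P))).
  rewrite mulrA coeftM_comp //; apply: eq_bigr => j _; congr (_ * _).
  rewrite riordan_subn riordan_col_addl exprMn -exprM [(l * j)%N]mulnC.
  by move: (C m) => c; rewrite mulSn exprD -!mulrA [c * ('t ^+ _ * _)]mulrCA.
split=> [Zz|eqZ [//|n] _]; last first.
  by rewrite sumE eqZ coeftB coeftC subr0.
apply/fpsP => -[|n]; last by rewrite -sumE -Zz // coeftB coeftC subr0.
by rewrite coeftXnM leqn0 gtn_eqF // coeftB coeftC subrr.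
Qed.

(** * Existence and uniqueness of the sequences *)

Hypothesis hg : Fseries0 l g.
Hypothesis hf : forall i, Fseries0 l (f i).

Lemma riordan_mult_unit : P \is a GRing.unit.
Proof. by apply: rpred_prod => i _; exact: Fseries0_unit (hf i). Qed.

Lemma riordan_mult_Fseries : Fseries l P.
Proof. by apply: Fseries_prod => i _; case: (hf i). Qed.

Lemma exists_unique_A_sequence : exists! a, is_A_sequence l (riordan g f) a.
Proof.
have g_neq0 : g != 0.
  by apply: contraTneq (Fseries0_unit hg) => ->; rewrite unitr0.
apply: (exists_unique_iff (fun a => is_A_sequenceP a g_neq0)).
have := exists_unique_comp_eq l_gt0 (@Fseries1 K l) riordan_mult_Fseries
  riordan_mult_Fseries (unitr1 _) riordan_mult_unit.
by apply: exists_unique_iff => a; rewrite mul1r.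
Qed.

Lemma exists_unique_Z_sequence m : exists! z, is_Z_sequence l (riordan g f) m z.
Proof.
apply: (exists_unique_iff (is_Z_sequenceP m)).
have FC : Fseries l (C m).
  apply: FseriesM; first by case: hg.
  by apply: Fseries_prod => i _; apply: FseriesXn; case: (hf i).
have C_unit : C m \is a GRing.unit.
  rewrite unitrM (Fseries0_unit hg) rpred_prod // => i _.
  by rewrite unitrX ?(Fseries0_unit (hf i)).
(* [q] is $(C_m-C_m(0))/t^l$: the division is exact because $C_m$ lies in $K[[t^l]]$ and so has no
   term of degree strictly between 0 and [l]. *)
pose q := Fps (fun n => [t^ (n + l)] (C m)).
have qn n : [t^ n] q = [t^ (n + l)] (C m) by [].
have Fq : Fseries l q by move=> n nl; rewrite qn FC // dvdn_addl.
have qE : C m - fpsC ([t^ 0] (C m)) = 't ^+ l * q.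
  apply/fpsP => n; rewrite coeftB coeftC coeftXnM.
  case: leqP => [leln|ltnl].
    by rewrite gtn_eqF ?(leq_trans l_gt0) // subr0 qn subnK.
  case: n ltnl => [|n] ltnl; first exact: subrr.
  by rewrite [LHS]subr0 FC // gtnNdvd.
have := exists_unique_comp_eq l_gt0 FC riordan_mult_Fseries Fq C_unit
  riordan_mult_unit.
apply: exists_unique_iff => z; rewrite qE; split=> [|-> //].
by move/(mulfI (expf_neq0 l (fpsX_neq0 K))).
Qed.

End RiordanColumns.

(** * Clearing denominators in the field of fractions *)

Lemma tofrac_eq_divP (R : idomainType) (x y w : R) : w != 0 ->
  x%:F = y%:F / w%:F <-> x * w = y.
Proof.
move=> w0; have wF0 : w%:F != 0 by rewrite tofrac_eq0.
split=> [xE|<-]; last by rewrite tofracM mulfK.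
by apply/eqP; rewrite -tofrac_eq tofracM xE divfK.
Qed.

Lemma tofrac_eq_Z_seriesP (R : idomainType) (z b c w : R) : b != 0 -> w != 0 ->
  z%:F = 1 / b%:F * (1 - c%:F / w%:F) <-> z * b * w = w - c.
Proof.
move=> b0 w0; have wF0 : w%:F != 0 by rewrite tofrac_eq0.
have -> : 1 / b%:F * (1 - c%:F / w%:F) = (w - c)%:F / (b * w)%:F.
  by rewrite -[X in X - _](divff wF0) -mulrBl mulf_div mul1r tofracB tofracM.
by rewrite tofrac_eq_divP ?mulf_neq0 // mulrA.
Qed.

(** * Transport of identities along a compositional inverse *)

Section CompInverse.
Variables (K : fieldType) (u v : {fps K}).
Hypothesis uv : is_comp_inverse u v.

(** Composing on the right with [v] undoes [u]. Hence an identity involving $\overline{th}$ may be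
    checked after substituting $th$. *)
Lemma fps_comp_eq_iff (x y : {fps K}) : x = y <-> fps_comp x u = fps_comp y u.
Proof.
case: uv => u0 v0 uvX _; split=> [-> //|].
by move/(congr1 (fun w => fps_comp w v)); rewrite !fps_compA // uvX !fps_compX.
Qed.

Lemma fps_comp_inverseK (x : {fps K}) : fps_comp (fps_comp x v) u = x.
Proof. by case: uv => u0 v0 _ vuX; rewrite fps_compA // vuX fps_compX. Qed.

Lemma comp_inverse_neq0 : v != 0.
Proof.
case: uv => u0 v0 _ vuX; apply: contraNneq (fpsX_neq0 K) => v_eq0.
by rewrite -vuX v_eq0 -(raddf0 (@fpsC K)) fps_compC.
Qed.

End CompInverse.

Theorem theorem4p5 (K : fieldType) (charK : [pchar K] =i pred0)
    (l : nat) (hl : (2 <= l)%N)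
    (g : {fps K}) (f : 'I_l -> {fps K})
    (hg : Fseries0 l g) (hf : forall i, Fseries0 l (f i)) :
  let d := riordan g f in
  let tf := assoc_mult f in
  [/\ exists! a : nat -> K, is_A_sequence l d a,
      exists! z : nat -> K, is_Z_sequence l d 0 z &
      forall m : nat, (1 <= m < l)%N ->
        exists! z : nat -> K, is_Z_sequence l d m z]
  /\
  forall h hb : {fps K},
    h ^+ l = \prod_(i < l) f i ->
    is_comp_inverse ('t * h) hb ->
    [/\ forall a : nat -> K, let A := gen_series l a in
          [<-> is_A_sequence l d a;
               fps_comp A ('t * h) = h ^+ l;
               A%:F = ('t ^+ l)%:F / (hb ^+ l)%:F],
        forall z : nat -> K, let Z0 := gen_series l z in
          is_Z_sequence l d 0 z <->
          Z0%:F = 1 / (hb ^+ l)%:F *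
                  (1 - (fpsC ([t^ 0] g))%:F / (fps_comp g hb)%:F) &
        forall m : nat, (1 <= m < l)%N ->
        forall z : nat -> K, let Zm := gen_series l z in
          is_Z_sequence l d m z <->
          Zm%:F = 1 / (hb ^+ l)%:F *
            (1 - (fpsC ([t^ 0] g * \prod_(i < l | (i < m)%N) [t^ 1] (tf i))
                    * hb ^+ m)%:F
                 / (fps_comp g hb
                    * \prod_(i < l | (i < m)%N) fps_comp (tf i) hb)%:F)].
Proof.
move=> d tf; have l_gt0 : (0 < l)%N by exact: ltnW.
have Z_ex m := exists_unique_Z_sequence l_gt0 hg hf m.
split; first by split=> //; exact: exists_unique_A_sequence.
move=> h hb hl_eq inv; set u := 't * h in inv.
have [u0 hb0 uhbX hbuX] := inv.
have uK := fps_comp_inverseK inv; have hbN0 := comp_inverse_neq0 inv.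
have tN0 k : ('t : {fps K}) ^+ k != 0 by rewrite expf_neq0 ?fpsX_neq0.
have ulE : u ^+ l = 't ^+ l * \prod_(i < l) f i by rewrite exprMn hl_eq.
have g_unit := Fseries0_unit hg.
have unitN0 (x : {fps K}) : x \is a GRing.unit -> x != 0.
  by apply: contraTneq => ->; rewrite unitr0.
have comp_u a : fps_comp (gen_series l a) u =
    fps_comp (Fps a) ('t ^+ l * \prod_(i < l) f i).
  by rewrite fps_comp_gen_series // ulE.
have comp_hbX k : fps_comp (hb ^+ k) u = 't ^+ k by rewrite fps_compXn // hbuX.
(* Parts (b) and (c) at once: [c] and [w] stand for the numerator and denominator of the inner
   fraction. After substitution of $th$ they become $t^mC_m(0)$ and $t^mC_m$. *)
have Z_iff m z c w : (m < l)%N ->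
    c = fpsC ([t^ 0] (riordan_col g f m)) * hb ^+ m ->
    fps_comp w u = 't ^+ m * riordan_col g f m ->
  is_Z_sequence l d m z <->
  (gen_series l z)%:F = 1 / (hb ^+ l)%:F * (1 - c%:F / w%:F).
  move=> ltml -> wE.
  (* Substituting $th$ in [w] gives a power of $t$ times a unit, hence not 0. *)
  have w0 : w != 0.
    apply: contra_eq_neq wE => ->; rewrite -(raddf0 (@fpsC K)) fps_compC raddf0.
    rewrite eq_sym mulf_neq0 //; apply: unitN0.
    rewrite unitrM g_unit rpred_prod // => i _.
    by rewrite unitrX ?(Fseries0_unit (hf i)).
  rewrite tofrac_eq_Z_seriesP ?expf_neq0 // (fps_comp_eq_iff inv).
  rewrite fps_compB !fps_compM // fps_compC !comp_hbX wE comp_u.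
  rewrite is_Z_sequenceP // [fpsC _ * _]mulrC -mulrBr.
  set A := fps_comp _ _; set B := _ - _.
  (* Up to the cancellable factor $t^m$, what remains is the series form of the $Z_m$-recurrence. *)
  have -> : A * 't ^+ l * ('t ^+ m * riordan_col g f m) =
     't ^+ m * ('t ^+ l * (riordan_col g f m * A)).
    by rewrite mulrCA -mulrA [A * _]mulrC -mulrA.
  by split=> [->//|]; apply: mulfI.
split=> [a A|z Z0|m /andP[m_gt0 ltml] z Zm].
- have A_comp : is_A_sequence l d a <-> fps_comp A u = h ^+ l.
    by rewrite is_A_sequenceP ?unitN0 // comp_u hl_eq.
  (* Cleared of its denominator and composed with $th$, the quotient formula becomes
     $A(th)\,t^l=t^lh^l$. *)
  have A_frac : A%:F = ('t ^+ l)%:F / (hb ^+ l)%:F <-> fps_comp A u = h ^+ l.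
    rewrite tofrac_eq_divP ?expf_neq0 //.
    apply: (iff_trans (fps_comp_eq_iff inv _ _)).
    rewrite fps_compM // comp_hbX fps_compXn // fps_compXl // exprMn mulrC.
    by split=> [|->//]; apply: mulfI.
  split; first by move/A_comp.
  by split; [move/A_frac | move/A_frac/A_comp].
- have C0 : riordan_col g f 0 = g.
    by rewrite riordan_col_small // big_pred0 ?mulr1 // => i; rewrite ltn0.
  by apply: Z_iff; rewrite // ?C0 ?mulr1 ?mul1r.
apply: Z_iff => //.
  (* $[t](tf_i)=f_i(0)$, so the constant in the numerator is $C_m(0)$. *)
  rewrite riordan_col_small // coeft0M coeft0_prod; congr (fpsC (_ * _) * _).
  by apply: eq_bigr => i _; rewrite /tf /assoc_mult -['t]expr1 coeftXnM subnn.
(* Substituting $th$ restores $g\prod_{i\le m}tf_i$; the [m] factors $t$ collect into $t^m$. *)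
rewrite -fps_comp_prod // -fps_compM // uK big_split /= mulrCA.
rewrite -(big_ord_widen l (fun=> 't) (ltnW ltml)) prodr_const card_ord.
by rewrite riordan_col_small.
Qed.
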